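(* Let $\mathbf{A}$ and $\mathbf{B}$ be totally ordered idempotent RLs. A function $h\colon A\to B$ is a homomorphism from $\mathbf{A}$ to $\mathbf{B}$ if and only if all of the following hold: (1) the set $I=h^{-1}[\{e\}]$ is an interval of $\mathbf{A}$ which contains $e$ and is closed under ${}^*$; (2) $h$ is an order embedding of $I_*$ into $B_e\setminus\{e\}$; (3) $h$ is an order embedding of $A^{**}\setminus I$ into $B^{**}\setminus\{e\}$ that preserves ${}^*$ (i.e. $h(a^* )=h(a)^*$ for $a\in A^{**}\setminus I$); (4) for every $a\in A^{**}\setminus I$, $h$ is an order embedding of $A_a$ into $B_{h(a)}$.
   Context: A (commutative) residuated lattice (RL) is an algebra $\langle A;\cdot,\to,\wedge,\vee,e\rangle$ such that $\langle A;\cdot,e\rangle$ is a commutative monoid, $\langle A;\wedge,\vee\rangle$ is a lattice (with order $\leqslant$), and $x\cdot y\leqslant z \iff y\leqslant x\to z$ for all $x,y,z$. It is idempotent if $a\cdot a=a$ for all $a$, and totally ordered if its lattice order is total. Homomorphisms preserve $\cdot,\to,\wedge,\vee,e$. Notation: $x^*:=x\to e$; $A^{**}:=\{a^{**}:a\in A\}$; for $c\in A^{**}$, $A_c:=\{a\in A: a^{**}=c\}$; similarly $B^{**}$ and $B_c$ for $c\in B^{**}$ (note $e=e^{**}\in B^{**}$). For $I\subseteq A$, $I_*:=\{a\in A: a\notin I \text{ and } a^*\in I\}$. An interval is a convex subset of the chain. An order embedding of $X$ into $Y$ is a map $g$ with $g[X]\subseteq Y$ and $x\leqslant y\iff g(x)\leqslant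 g(y)$ for $x,y\in X$. *)

(* Defs.v *)
From HB Require Import structures.
From mathcomp Require Import all_boot all_order.
From mathcomp Require Import monoid.
From mathcomp Require Import boolp classical_sets.

Set Implicit Arguments.
Unset Strict Implicit.
Unset Printing Implicit Defensive.

Import Order.TTheory.

Local Open Scope classical_set_scope.
Local Open Scope group_scope.
Local Open Scope order_scope.

(* The identity element e is the unit 1%g of the underlying monoid. *)
HB.mixin Record Monoid_Lattice_isResiduated (d : Order.disp_t) A
    of Monoid A & Order.Lattice d A := {
  rlmulC : forall x y : A, x * y = y * x;
  rlimp : A -> A -> A;
  rlimpP : forall x y z : A, (x * y <= z) <-> (y <= rlimp x z)
}.

#[short(type="residLatticeType")]
HB.structure Definition ResidLattice (d : Order.disp_t) :=
  { A of Monoid_Lattice_isResiduated d A & Monoid A & Order.Lattice d A }.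

HB.mixin Record ResidLattice_isIdempotent (d : Order.disp_t) A
    of ResidLattice d A := {
  rlmulxx : forall x : A, x * x = x
}.

#[short(type="idemResidChainType")]
HB.structure Definition IdemResidChain (d : Order.disp_t) :=
  { A of ResidLattice d A & ResidLattice_isIdempotent d A & Order.Total d A }.

Definition rlstar (d : Order.disp_t) (A : residLatticeType d) (x : A) : A :=
  rlimp x 1.

Notation "x ^⋆" := (rlstar x) (at level 2, left associativity, format "x ^⋆").

Definition rl_hom (d d' : Order.disp_t) (A : residLatticeType d)
    (B : residLatticeType d') (h : A -> B) : Prop :=
  [/\ {morph h : x y / x * y >-> x * y},
      {morph h : x y / rlimp x y >-> rlimp x y},
      {morph h : x y / x `&` y >-> x `&` y},
      {morph h : x y / x `|` y >-> x `|` y} &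
      h 1 = 1].

Definition dstars (d : Order.disp_t) (A : residLatticeType d) : set A :=
  [set a^⋆^⋆ | a in [set: A]]%classic.

Arguments dstars {d} A _.

Definition dstar_fiber (d : Order.disp_t) (A : residLatticeType d) (c : A) :
  set A := [set a : A | a^⋆^⋆ = c]%classic.

Definition lower_star (d : Order.disp_t) (A : residLatticeType d) (I : set A) :
  set A := [set a : A | ~ I a /\ I a^⋆]%classic.

Definition convex_set (d : Order.disp_t) (T : porderType d) (E : set T) :
  Prop := forall x y, E x -> E y -> forall z, x <= z <= y -> E z.

Definition order_embedding (d d' : Order.disp_t) (S : porderType d)
    (T : porderType d') (X : set S) (Y : set T) (g : S -> T) : Prop :=
  (forall x, X x -> Y (g x)) /\
  (forall x y, X x -> X y -> (x <= y <-> g x <= g y)).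

(* Main.v *)
Require Import Defs.
From HB Require Import structures.
From mathcomp Require Import all_boot all_order.
From mathcomp Require Import monoid.
From mathcomp Require Import boolp classical_sets.

(** In a totally ordered idempotent RL both operations are determined by the
    order and [*]: [x * y] is [min x y] if [x <= y^*] and [max x y] otherwise,
    while [x -> z] is [max x^* z] if [x <= z] and [min x^* z] otherwise.  Hence
    [h] is a homomorphism iff it fixes [e], preserves [*], is monotone, is
    injective outside [I], and every [y] outside [I] with [y^*] in [I] lies
    below [I].  Conditions (1)-(4) describe such a map along the partition of
    [A] into [I], [I_*] and the fibers [A_c] with [c] in [A^**] outside [I]. *)

Set Implicit Arguments.
Unset Strict Implicit.
Unset Printing Implicit Defensive.

Import Order.TTheory.

Local Open Scope group_scope.
Local Open Scope order_scope.

(** * The map [⋆] and its double in a residuated lattice *)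

Section ResidLatticeTheory.
Variables (d : Order.disp_t) (A : residLatticeType d).
Implicit Types x y z : A.

Lemma rlmul_le1 x y : (x * y <= 1) = (y <= x^⋆).
Proof. by apply/idP/idP => /rlimpP. Qed.

(** By commutativity both sides say [x * y <= 1]. Thus [⋆] forms an antitone Galois connection with
    itself, which gives the usual laws below. *)
Lemma rlstar_sym x y : (x <= y^⋆) = (y <= x^⋆).
Proof. by rewrite -!rlmul_le1 rlmulC. Qed.

Lemma rlstar1 : (1 : A)^⋆ = 1.
Proof.
apply/eqP; rewrite eq_le; apply/andP; split.
  by rewrite -[X in X <= _]mul1g rlmul_le1.
by rewrite -rlmul_le1 mul1g.
Qed.

Lemma le_rldstar x : x <= x^⋆^⋆.
Proof. by rewrite rlstar_sym. Qed.

Lemma rlstar_anti x y : x <= y -> y^⋆ <= x^⋆.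
Proof. by move=> lexy; rewrite rlstar_sym (le_trans lexy) ?le_rldstar. Qed.

Lemma rlstar3 x : x^⋆^⋆^⋆ = x^⋆.
Proof. by apply/eqP; rewrite eq_le le_rldstar rlstar_anti ?le_rldstar. Qed.

Lemma rldstar_homo x y : x <= y -> x^⋆^⋆ <= y^⋆^⋆.
Proof. by move=> lexy; do 2!apply: rlstar_anti. Qed.

Lemma rlstar_ge1 x : (1 <= x^⋆) = (x <= 1).
Proof. by rewrite rlstar_sym rlstar1. Qed.

Lemma rlstar_le1 x : 1 <= x -> x^⋆ <= 1.
Proof. by move/rlstar_anti; rewrite rlstar1. Qed.

Lemma rlmul_homo x y z t : x <= y -> z <= t -> x * z <= y * t.
Proof.
move=> lexy lezt; apply: (@le_trans _ _ (x * t)).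
  by apply/rlimpP; apply: le_trans lezt _; apply/rlimpP.
by rewrite ![_ * t]rlmulC; apply/rlimpP; apply: le_trans lexy _; apply/rlimpP.
Qed.

Lemma rlimp_ge1 x y : (1 <= rlimp x y) = (x <= y).
Proof.
by apply/idP/idP => [/rlimpP|lexy]; [rewrite mulg1|apply/rlimpP; rewrite mulg1].
Qed.

Lemma dstarsP x : dstars A x <-> x^⋆^⋆ = x.
Proof. by split=> [[y _ <-]|<-]; [rewrite rlstar3|exists x]. Qed.

Lemma dstars_star x : dstars A x^⋆.
Proof. by apply/dstarsP; rewrite rlstar3. Qed.

Variable I : set A.
Hypothesis Istar : forall x, I x -> I x^⋆.

Lemma kernel_dstar x : I x^⋆^⋆ <-> I x^⋆.
Proof. by split=> /Istar //; rewrite rlstar3. Qed.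

Lemma notin_kernel_dstar x : ~ I x^⋆^⋆ -> ~ I x.
Proof. by move=> nI Ix; apply/nI/Istar/Istar. Qed.

End ResidLatticeTheory.

(** * Explicit operations in idempotent chains *)

Section IdemResidChainTheory.
Variables (d : Order.disp_t) (A : idemResidChainType d).
Implicit Types x y z : A.

Lemma rlmul_idemE x y :
  x * y = if x <= y^⋆ then x `&` y else x `|` y.
Proof.
wlog lexy : x y / x <= y.
  move=> H; have [/H//|/H] := orP (le_total x y).
  by rewrite rlmulC rlstar_sym meetC joinC.
rewrite meet_l // join_r //.
have lexm : x <= x * y by rewrite -[X in X <= _](rlmulxx x) rlmul_homo.
have lemy : x * y <= y by rewrite -[X in _ <= X](rlmulxx y) rlmul_homo.
rewrite rlstar_sym -rlmul_le1; apply/eqP; rewrite eq_le.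
case: (leP (x * y) 1) => [le1|/ltW ge1].
- by rewrite lexm andbT -{1}(rlmulxx x) -mulgA -[X in _ <= X]mulg1 rlmul_homo.
- by rewrite lemy -{2}(rlmulxx y) mulgA -{1}[y]mul1g rlmul_homo.
Qed.

Lemma rlimp_idemE x z :
  rlimp x z = if x <= z then x^⋆ `|` z else x^⋆ `&` z.
Proof.
(* Both sides are identified by having the same lower bounds [y]; residuation turns the left one
   into the product formula. *)
suff E y : (y <= rlimp x z) = (y <= if x <= z then x^⋆ `|` z else x^⋆ `&` z).
  by apply/eqP; rewrite eq_le -E lexx E lexx.
have -> : (y <= rlimp x z) = (x * y <= z) by apply/idP/idP => /rlimpP.
rewrite rlmul_idemE rlstar_sym.
have [lexz|ltzx] := leP x z; have [leyx|ltxy] := leP y x^⋆.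
- by rewrite lexU leyx leIx ?lexz.
- by rewrite leUx lexz lexU [y <= x^⋆]leNgt ltxy.
- by rewrite lexI leyx leIx [x <= z]leNgt ltzx.
- by rewrite leUx lexI [x <= z]leNgt [y <= x^⋆]leNgt ltzx ltxy.
Qed.

Variable I : set A.
Hypotheses (Istar : forall x, I x -> I x^⋆) (Iconv : convex_set I).

(** If [i <= x], then [x] lies between [i] and [x^⋆^⋆], both in [I], and convexity puts it in
    [I]. *)
Lemma lower_star_lt x i : lower_star I x -> I i -> x < i.
Proof.
move=> [nIx Ixs] Ii; rewrite ltNge; apply/negP => leix; apply: nIx.
by apply: (Iconv Ii (Istar Ixs)); rewrite leix le_rldstar.
Qed.

End IdemResidChainTheory.

Section RlHomTheory.
Variables (d d' : Order.disp_t).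
Variables (A : idemResidChainType d) (B : idemResidChainType d').
Variables (h : A -> B).

(** * Properties of a given homomorphism *)

Section Necessity.
Hypothesis homh : rl_hom h.

Lemma rl_hom_star x : h x^⋆ = (h x)^⋆.
Proof. by case: homh => _ hI _ _ h1; rewrite /rlstar hI h1. Qed.

Lemma rl_hom_le x y : x <= y -> h x <= h y.
Proof. by case: homh => _ _ hI _ _ /meet_l <-; rewrite hI leIr. Qed.

(* If [y < x] and [h x = h y] then [h] maps [x -> y = min x^* y] above [e], so
   both [h y] and [h x^*] are above [e]. *)
Lemma rl_hom_inj x y : h x = h y -> x = y \/ h x = 1.
Proof.
wlog: x y / y <= x.
  move=> H; have [/H//|/ltW/H{}H] := leP y x.
  by move=> E; have [->|Ey] := H (esym E); [left|right; rewrite E].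
rewrite le_eqVlt => /predU1P[->|ltyx E]; first by left.
right; case: (homh) => _ hI hm _ _.
have : 1 <= h (rlimp x y) by rewrite hI rlimp_ge1 E.
rewrite rlimp_idemE [x <= y]leNgt ltyx /= hm lexI.
rewrite rl_hom_star rlstar_ge1 -E => /andP[le1 ge1].
by apply/eqP; rewrite eq_le le1.
Qed.

(** Monotonicity and injectivity away from the kernel reflect the order; this serves all three
    embeddings of the theorem. *)
Lemma rl_hom_embedding (X : set A) (Y : set B) :
    (forall x, X x -> Y (h x)) -> (forall x, X x -> h x <> 1) ->
  order_embedding X Y h.
Proof.
move=> XY X1; split=> // x y Xx Xy; split; first exact: rl_hom_le.
move=> lehxy; case: leP => // ltyx.
have E : h x = h y by apply/eqP; rewrite eq_le lehxy rl_hom_le ?ltW.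
by case: (rl_hom_inj E) => [xy|/X1//]; rewrite xy ltxx in ltyx.
Qed.

End Necessity.

(** The operations are given by case distinctions on an order test. A monotone [h] can change the
    outcome of a test only by identifying the two elements compared, and [hinj] then sends both to
    [1]. *)
Lemma rl_hom_of_star_le_inj :
    h 1 = 1 -> (forall x, h x^⋆ = (h x)^⋆) -> {homo h : x y / x <= y} ->
    (forall x y, h x = h y -> x = y \/ h x = 1) ->
    (forall x y, lower_star [set z | h z = 1]%classic x -> h y = 1 -> x < y) ->
  rl_hom h.
Proof.
move=> h1 hs hle hinj hlow.
have hmeet : {morph h : x y / x `&` y >-> x `&` y}.
  move=> x y; have [lexy|/ltW leyx] := leP x y.
    by rewrite !meet_l ?hle.
  by rewrite !meet_r ?hle.
have hjoin : {morph h : x y / x `|` y >-> x `|` y}.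
  move=> x y; have [lexy|/ltW leyx] := leP x y.
    by rewrite !join_r ?hle.
  by rewrite !join_l ?hle.
split=> // x y; last first.
  rewrite !rlimp_idemE; have [lexy|ltyx] := leP x y.
    by rewrite hle // hjoin hs.
  have [le_hxy|] := leP (h x) (h y); last by rewrite hmeet hs.
  have E : h x = h y by apply/eqP; rewrite eq_le le_hxy hle ?ltW.
  have [xy|hx1] := hinj _ _ E; first by rewrite xy ltxx in ltyx.
  by rewrite hmeet hs -E hx1 rlstar1 meetxx joinxx.
rewrite !rlmul_idemE; have [lexy|ltyx] := leP x y^⋆.
  by rewrite -hs hle // hmeet.
have [le_hxy|] := leP (h x) (h y)^⋆; last by rewrite hjoin.
have E : h x = h y^⋆ by apply/eqP; rewrite eq_le {1}hs le_hxy hle ?ltW.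
have [xy|hx1] := hinj _ _ E; first by rewrite xy ltxx in ltyx.
have [hy1|hy1] := pselect (h y = 1).
  by rewrite hjoin hy1 hx1 meetxx joinxx.
(* Here [y] lies outside the kernel while [y^⋆] and [x^⋆] lie in it; [hlow] then contradicts
   [y^⋆ < x]. *)
have ltyxs : y < x^⋆.
  by apply: hlow; [split; rewrite //= -E|rewrite hs hx1 rlstar1].
by move: (ltW ltyxs); rewrite rlstar_sym leNgt ltyx.
Qed.

(** * From the four conditions to a homomorphism *)

Section Sufficiency.
Let I : set A := (h @^-1` [set 1])%classic.
Hypotheses (Iconv : convex_set I) (I1 : I 1).
Hypothesis Istar : forall a, I a -> I a^⋆.
Hypothesis hlow :
  order_embedding (lower_star I) (dstar_fiber 1 `\` [set 1])%classic h.
Hypothesis hds :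
  order_embedding (dstars A `\` I)%classic (dstars B `\` [set 1])%classic h.
Hypothesis hds_star : forall a, (dstars A `\` I)%classic a -> h a^⋆ = (h a)^⋆.
Hypothesis hfib : forall a, (dstars A `\` I)%classic a ->
  order_embedding (dstar_fiber a) (dstar_fiber (h a)) h.

Let star_dstarsD x : ~ I x^⋆ -> (dstars A `\` I)%classic x^⋆.
Proof. by split=> //; apply: dstars_star. Qed.

Lemma star_of_embeddings x : h x^⋆ = (h x)^⋆.
Proof.
have [Ix|nIx] := pselect (I x).
  by rewrite (Istar Ix) (Ix : h x = 1) rlstar1.
have [Ixs|nIxs] := pselect (I x^⋆).
  rewrite (Ixs : h x^⋆ = 1).
  (* Since [h x] is in the fiber of [1], [(h x)^⋆ = (h x)^⋆^⋆^⋆ = 1^⋆ = 1]. *)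
  by have [/= E _] := hlow.1 _ (conj nIx Ixs); rewrite -rlstar3 E rlstar1.
have nIxss : ~ I x^⋆^⋆ by move/(kernel_dstar Istar).
have D := star_dstarsD nIxss.
have /= E := (hfib D).1 x erefl.
by rewrite -[RHS]rlstar3 E -hds_star // rlstar3.
Qed.

Let dstarsD_star c : (dstars A `\` I)%classic c -> (dstars A `\` I)%classic c^⋆.
Proof.
move=> [/dstarsP cE nIc]; apply: star_dstarsD => Ics.
by apply: nIc; rewrite -cE; apply: Istar.
Qed.

(** The embedding [hds] says nothing about [1], which lies in [I]. The side of [1] on which [c] lies
    is instead read off by comparing [c] with [c^⋆], a comparison that [h] preserves. *)
Lemma sign_of_embeddings c : (dstars A `\` I)%classic c ->
  (c <= 1 -> h c <= 1) /\ (1 <= c -> 1 <= h c).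
Proof.
move=> Dc; have Dcs := dstarsD_star Dc; split=> [le1|ge1].
- have : h c <= h c^⋆.
    by apply/(hds.2 _ _ Dc Dcs); rewrite (le_trans le1) ?rlstar_ge1.
  rewrite star_of_embeddings => le_hc; case: leP => // /[dup] /ltW /rlstar_le1.
  by move=> /(le_trans le_hc) hc_le1; rewrite ltNge hc_le1.
- have : h c^⋆ <= h c.
    by apply/(hds.2 _ _ Dcs Dc); rewrite (le_trans _ ge1) ?rlstar_le1.
  rewrite star_of_embeddings => le_hc; case: leP => // /[dup] /ltW.
  by rewrite -rlstar_ge1 => /le_trans/(_ le_hc) hc_ge1; rewrite ltNge hc_ge1.
Qed.

Lemma le_dstars_of_embeddings c c' :
  dstars A c -> dstars A c' -> c <= c' -> h c <= h c'.
Proof.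
move=> Dc Dc' lecc'.
have [Ic|nIc] := pselect (I c); have [Ic'|nIc'] := pselect (I c').
- by rewrite (Ic : h c = 1) (Ic' : h c' = 1).
(* Convexity of [I] forces [1 <= c'], since [c <= c' <= 1] would put [c'] in [I]. *)
- rewrite (Ic : h c = 1); apply: (sign_of_embeddings (conj Dc' nIc')).2.
  case: leP => // /ltW le1; case: nIc'.
  by apply: (Iconv Ic I1); rewrite lecc'.
- rewrite (Ic' : h c' = 1); apply: (sign_of_embeddings (conj Dc nIc)).1.
  case: leP => // /ltW ge1; case: nIc.
  by apply: (Iconv I1 Ic'); rewrite ge1.
- by apply/(hds.2 _ _ (conj Dc nIc) (conj Dc' nIc')).
Qed.

(** Separates the two ways of having equal images: one common fiber outside [I], or both points in
    the union of [I] and [lower_star I]. *)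
Let inj_dstars x y : h x^⋆^⋆ = h y^⋆^⋆ ->
  x^⋆^⋆ = y^⋆^⋆ /\ ~ I x^⋆^⋆ \/ I x^⋆ /\ I y^⋆.
Proof.
move=> E; have [Ix|nIx] := pselect (I x^⋆^⋆).
  by right; split; apply/(kernel_dstar Istar) => //; rewrite /I /= -E.
left; split=> //; have nIy : ~ I y^⋆^⋆ by rewrite /I /= -E.
have [Dx Dy] := (star_dstarsD nIx, star_dstarsD nIy).
apply/eqP; rewrite eq_le.
by apply/andP; split; apply/hds.2 => //; rewrite E.
Qed.

Lemma le_of_embeddings : {homo h : x y / x <= y}.
Proof.
move=> x y lexy.
have := rldstar_homo lexy.
move=> /(le_dstars_of_embeddings (dstars_star _) (dstars_star _)).
rewrite le_eqVlt => /predU1P[E|]; last first.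
  (* A strict inequality between [(h x)^⋆^⋆] and [(h y)^⋆^⋆] descends to [h x] and [h y], because
     double star is monotone and the order total. *)
  rewrite !star_of_embeddings => ltxy; case: leP => // /ltW /rldstar_homo.
  by rewrite leNgt ltxy.
case: (inj_dstars E) => [[xy nIx]|[Ixs Iys]].
  by apply/((hfib (star_dstarsD nIx)).2 x y).
have [Ix|nIx] := pselect (I x); have [Iy|nIy] := pselect (I y).
- by rewrite (Ix : h x = 1) (Iy : h y = 1).
- by have := lower_star_lt Istar Iconv (conj nIy Iys) Ix; rewrite ltNge lexy.
(* The fiber of [1] in [B] lies below [1], as [h x <= (h x)^⋆^⋆]. *)
- have [/= E1 _] := hlow.1 _ (conj nIx Ixs).
  by rewrite (Iy : h y = 1) -E1 le_rldstar.
- by apply/(hlow.2 _ _ (conj nIx Ixs) (conj nIy Iys)).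
Qed.

Lemma inj_of_embeddings x y : h x = h y -> x = y \/ h x = 1.
Proof.
move=> E; have [hx1|nIx] := pselect (h x = 1); [by right|left].
have nIy : ~ I y by rewrite /I /= -E.
have Edd : h x^⋆^⋆ = h y^⋆^⋆ by rewrite !star_of_embeddings E.
apply/eqP; rewrite eq_le; case: (inj_dstars Edd) => [[xy nIxss]|[Ixs Iys]].
- have [_ emb] := hfib (star_dstarsD nIxss).
  by apply/andP; split; apply/emb => //; rewrite E.
- have [Lx Ly] := (conj nIx Ixs : lower_star I x, conj nIy Iys : lower_star I y).
  by apply/andP; split; apply/hlow.2 => //; rewrite E.
Qed.

Lemma rl_hom_of_embeddings : rl_hom h.
Proof.
apply: rl_hom_of_star_le_inj => //.
- exact: star_of_embeddings.
- exact: le_of_embeddings.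
- exact: inj_of_embeddings.
- by move=> x y Lx hy1; apply: (lower_star_lt Istar Iconv Lx).
Qed.

End Sufficiency.
End RlHomTheory.

Theorem theorem6p5 (d d' : Order.disp_t) (A : idemResidChainType d)
    (B : idemResidChainType d') (h : A -> B) :
  let I : set A := (h @^-1` [set 1%g])%classic in
  rl_hom h <->
  [/\ [/\ convex_set I, I 1%g & forall a : A, I a -> I a^⋆],
      order_embedding (lower_star I) (dstar_fiber 1%g `\` [set 1%g])%classic h,
      order_embedding (dstars A `\` I)%classic
        (dstars B `\` [set 1%g])%classic h /\
      (forall a : A, (dstars A `\` I)%classic a -> h a^⋆ = (h a)^⋆) &
      forall a : A, (dstars A `\` I)%classic a ->
        order_embedding (dstar_fiber a) (dstar_fiber (h a)) h].
Proof.
move=> I; split=> [homh|[[Iconv I1 Istar] hlow [hds hdss] hfib]]; last first.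
  exact: rl_hom_of_embeddings.
have hs := rl_hom_star homh.
have Istar a : I a -> I a^⋆ by rewrite /I /= hs => ->; rewrite rlstar1.
split.
- split=> //; last by case: homh.
  move=> x y Ix Iy z /andP[/(rl_hom_le homh) lexz /(rl_hom_le homh) lezy].
  by apply/eqP; rewrite eq_le -{1}Iy -Ix lexz lezy.
- apply: rl_hom_embedding => // x [nIx Ixs] //; split=> //=.
  by rewrite /dstar_fiber /= -hs (Ixs : h x^⋆ = 1%g) rlstar1.
- split=> [|a _]; last exact: hs.
  apply: rl_hom_embedding => // x [/dstarsP xE nIx] //; split=> //.
  by apply/dstarsP; rewrite -!hs xE.
- move=> a [_ nIa]; apply: rl_hom_embedding => // x /= xa.
    by rewrite /dstar_fiber /= -!hs xa.
  (* A fiber over a point outside [I] misses [I], which is closed under double star. *)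
  by apply: (notin_kernel_dstar Istar); rewrite xa.
Qed.
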